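(* $\textsc{Empty-Child}=_{dt}\textsc{Lossy-Code}$; that is, $\textsc{Empty-Child}\le_{dt}\textsc{Lossy-Code}$ and $\textsc{Lossy-Code}\le_{dt}\textsc{Empty-Child}$.
   Context: Query model: inputs consist of functions between finite sets, accessed by querying the bits of the binary encodings of their values. For query total search problems $R,S$, $R\le_{dt}S$ means that each instance of $R$ (of size parameter $N$) can be solved via an instance of $S$ whose input bits are each computed by decision trees over the $R$-input, and whose solutions are mapped back to solutions of $R$ by decision trees, where the logarithm of the $S$-instance input length plus the maximum decision-tree depth is $\mathrm{polylog}(N)$. $\textsc{Lossy-Code}$: given $f:[N]\to[2N]$ and $g:[2N]\to[N]$, find $x\in[2N]$ with $f(g(x))\neq x$. $\textsc{Empty-Child}$: given a vertex set $V=[N]$ and functions $F,L,R:V\to V$ (father, left child, right child), a solution is either (s1) a vertex $u\in V$ with $F(L(u))\neq u$ or $F(R(u))\neq u$ or $L(u)=R(u)\neq u$; or (s2) the vertex $1$, if $L(1)=1$ or $R(1)=1$ or $F(1)\neq 1$. *)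

(* Defs.v *)
From mathcomp Require Import all_boot.

Set Implicit Arguments.
Unset Strict Implicit.
Unset Printing Implicit Defensive.

(* The set [n] is represented by 'I_n, so the element i.+1 of [n] is the ordinal
   of value i; in particular the vertex 1 is the ordinal of value 0. *)

Record signature := Signature {
  fsym : finType;
  dom : fsym -> nat;
  cod : fsym -> nat }.

Definition input (sg : signature) : Type :=
  forall k : fsym sg, 'I_(dom k) -> 'I_(cod k).

(* Number of bits of the binary encoding of an element of [n]: the least l
   with n <= 2 ^ l. *)
Definition bitlen (n : nat) : nat := up_log 2 n.

(* [Tagged _ (i, j)] at the symbol k asks for bit j of the value of the k-th
   function at i. *)
Definition query (sg : signature) : finType :=
  {k : fsym sg & ('I_(dom k) * 'I_(bitlen (cod k)))%type}.

Definition nat_bit (v j : nat) : bool := odd (v %/ 2 ^ j).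

Definition answer (sg : signature) (x : input sg) (q : query sg) : bool :=
  nat_bit (x (tag q) (tagged q).1) (tagged q).2.

(* When n is not a power of 2 some bit strings encode no element of [n]; an
   input is nevertheless always a family of genuine functions, determined by
   the answers to its queries. *)
Lemma nat_bit_inj l v w : v < 2 ^ l -> w < 2 ^ l ->
  (forall j, j < l -> nat_bit v j = nat_bit w j) -> v = w.
Proof.
elim: l v w => [|l IHl] v w; first by rewrite !ltnS !leqn0 => /eqP-> /eqP->.
move=> lt_v lt_w eq_vw.
have half_lt u : u < 2 ^ l.+1 -> u %/ 2 < 2 ^ l.
  by rewrite ltn_divLR // expnSr.
have eq_half : v %/ 2 = w %/ 2.
  apply: IHl; [exact: half_lt | exact: half_lt | move=> j lt_j].
  by have := eq_vw j.+1 lt_j; rewrite /nat_bit expnS !divnMA.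
have eq_odd : odd v = odd w by have := eq_vw 0 isT; rewrite /nat_bit !divn1.
by rewrite -(odd_double_half v) -(odd_double_half w) -!divn2 eq_half eq_odd.
Qed.

Lemma answer_inj (sg : signature) (x y : input sg) :
  (forall q, answer x q = answer y q) -> forall k i, x k i = y k i.
Proof.
move=> eq_xy k i; apply/val_inj/(@nat_bit_inj (bitlen (cod k))).
- exact: leq_trans (ltn_ord _) (up_logP _ _).
- exact: leq_trans (ltn_ord _) (up_logP _ _).
by move=> j lt_j; exact: (eq_xy (Tagged _ (i, Ordinal lt_j))).
Qed.

Inductive dtree (Q A : Type) : Type :=
| Leaf of A
| Node of Q & dtree Q A & dtree Q A.

Fixpoint depth (Q A : Type) (t : dtree Q A) : nat :=
  match t with
  | Leaf _ => 0
  | Node _ t0 t1 => (maxn (depth t0) (depth t1)).+1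
  end.

Fixpoint eval (Q A : Type) (t : dtree Q A) (a : Q -> bool) : A :=
  match t with
  | Leaf b => b
  | Node q t0 t1 => if a q then eval t1 a else eval t0 a
  end.

Record search_problem := SearchProblem {
  sig_of : nat -> signature;
  solution : nat -> finType;
  is_sol : forall N : nat, input (sig_of N) -> solution N -> bool;
  totality : forall N : nat, 0 < N ->
    forall x : input (sig_of N), exists s : solution N, is_sol x s }.

Definition input_length (S : search_problem) (N : nat) : nat :=
  #|query (sig_of S N)|.

(* The trees [T] compute the bits of an instance y of S of size M from an
   instance x of R of size N, and [U s] turns the solution s of y into a
   solution of x.  By [answer_inj], y is unique up to extensionality. *)
Definition reduces_via (R S : search_problem) (N M : nat)
    (T : query (sig_of S M) -> dtree (query (sig_of R N)) bool)
    (U : solution S M -> dtree (query (sig_of R N)) (solution R N)) : Prop :=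
  forall x : input (sig_of R N), exists y : input (sig_of S M),
    (forall q, answer y q = eval (T q) (answer x)) /\
    (forall s, is_sol y s -> is_sol x (eval (U s) (answer x))).

Definition polylog (cost : nat -> nat) : Prop :=
  exists c : nat, forall N, 0 < N -> cost N <= c * up_log 2 N ^ c + c.

Definition dt_reducible (R S : search_problem) : Prop :=
  exists cost : nat -> nat, polylog cost /\
    forall N : nat, 0 < N -> exists M : nat, 0 < M /\
      exists (T : query (sig_of S M) -> dtree (query (sig_of R N)) bool)
             (U : solution S M -> dtree (query (sig_of R N)) (solution R N))
             (d : nat),
        [/\ reduces_via T U,
            forall q, depth (T q) <= d,
            forall s, depth (U s) <= d &
            up_log 2 (input_length S M) + d <= cost N].

Definition dt_equiv (R S : search_problem) : Prop :=
  dt_reducible R S /\ dt_reducible S R.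

Definition lc_sig (N : nat) : signature :=
  @Signature bool (fun b => if b then 2 * N else N)
                  (fun b => if b then N else 2 * N).

Definition lc_f (N : nat) (x : input (lc_sig N)) : 'I_N -> 'I_(2 * N) := x false.
Definition lc_g (N : nat) (x : input (lc_sig N)) : 'I_(2 * N) -> 'I_N := x true.

Definition lc_is_sol (N : nat) (x : input (lc_sig N)) (i : 'I_(2 * N)) : bool :=
  lc_f x (lc_g x i) != i.

Lemma lc_total (N : nat) : 0 < N ->
  forall x : input (lc_sig N), exists i, lc_is_sol x i.
Proof.
move=> N_gt0 x; apply/existsP; apply: contraT.
rewrite negb_exists => /forallP nosol.
have gK : cancel (lc_g x) (lc_f x).
  by move=> i; apply/eqP; have := nosol i; rewrite negbK.
have := leq_card _ (can_inj gK).
by rewrite !card_ord mul2n -addnn -{3}[N]addn0 leq_add2l leqNgt N_gt0.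
Qed.

Definition Lossy_Code : search_problem :=
  @SearchProblem lc_sig (fun N => 'I_(2 * N)) lc_is_sol lc_total.

Definition ec_sig (N : nat) : signature :=
  @Signature (option bool) (fun _ => N) (fun _ => N).

Definition ec_F (N : nat) (x : input (ec_sig N)) : 'I_N -> 'I_N := x None.
Definition ec_L (N : nat) (x : input (ec_sig N)) : 'I_N -> 'I_N := x (Some false).
Definition ec_R (N : nat) (x : input (ec_sig N)) : 'I_N -> 'I_N := x (Some true).

Definition ec_s1 (N : nat) (x : input (ec_sig N)) (u : 'I_N) : bool :=
  [|| ec_F x (ec_L x u) != u, ec_F x (ec_R x u) != u
    | (ec_L x u == ec_R x u) && (ec_R x u != u)].

Definition ec_s2 (N : nat) (x : input (ec_sig N)) (u : 'I_N) : bool :=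
  (val u == 0) && [|| ec_L x u == u, ec_R x u == u | ec_F x u != u].

Definition ec_is_sol (N : nat) (x : input (ec_sig N)) (u : 'I_N) : bool :=
  ec_s1 x u || ec_s2 x u.

(* The vertices that are 1 or not their own father would have two distinct
   children each, all of them of the same kind. *)
Lemma ec_total (N : nat) : 0 < N ->
  forall x : input (ec_sig N), exists u, ec_is_sol x u.
Proof.
move=> N_gt0 x; apply/existsP; apply: contraT.
rewrite negb_exists => /forallP nosol.
set F := ec_F x; set L := ec_L x; set R := ec_R x.
have LK : cancel L F.
  move=> u; have := nosol u; rewrite /ec_is_sol /ec_s1 !negb_or !negbK.
  by case/andP=> /and3P[/eqP].
have RK : cancel R F.
  move=> u; have := nosol u; rewrite /ec_is_sol /ec_s1 !negb_or !negbK.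
  by case/andP=> /and3P[_ /eqP].
pose T := [set u : 'I_N | (F u != u) || (val u == 0)].
have T_L u : u \in T -> L u != u.
  rewrite inE => /orP[|u0]; first by apply: contraNneq => {1}<-; rewrite LK.
  have := nosol u; rewrite /ec_is_sol /ec_s2 negb_or u0 /= !negb_or.
  by case/andP=> _ /and3P[].
have T_R u : u \in T -> R u != u.
  rewrite inE => /orP[|u0]; first by apply: contraNneq => {1}<-; rewrite RK.
  have := nosol u; rewrite /ec_is_sol /ec_s2 negb_or u0 /= !negb_or.
  by case/andP=> _ /and3P[].
have T_LR u : u \in T -> L u != R u.
  move=> Tu; have := nosol u; rewrite /ec_is_sol /ec_s1 !negb_or.
  by case/andP=> /and3P[_ _]; rewrite negb_and -/R (T_R u Tu) orbF.
have sub : L @: T :|: R @: T \subset T.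
  apply/subsetP=> v /setUP[] /imsetP[u Tu ->]; rewrite inE ?LK ?RK eq_sym.
    by rewrite T_L.
  by rewrite T_R.
have dis : [disjoint L @: T & R @: T].
  apply/pred0P=> v /=; apply: contraTF isT => /andP[/imsetP[u Tu ->]].
  case/imsetP=> w Tw eqLR; have := congr1 F eqLR; rewrite LK RK => eq_uw.
  by have := T_LR u Tu; rewrite eqLR eq_uw eqxx.
have := subset_leq_card sub.
rewrite cardsU (disjoint_setI0 dis) cards0 subn0.
rewrite !card_imset; [|exact: can_inj RK|exact: can_inj LK].
rewrite -{3}[#|T|]addn0 leq_add2l leqn0 cards_eq0 => /eqP T0.
suff : Ordinal N_gt0 \in T by rewrite T0 inE.
by rewrite inE orbT.
Qed.

Definition Empty_Child : search_problem :=
  @SearchProblem ec_sig (fun N => 'I_N) ec_is_sol ec_total.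

(* Main.v *)
(** Lossy-Code to Empty-Child: composing the code with itself turns
    [g : [2N] -> [N]] into an injection of [4N >= 2(N + 1)] points into [N], so
    that a fresh root and [N] other vertices can all be given two distinct
    children outside the root.

    Empty-Child to Lossy-Code: a string of [log N + 1] bits is compressed into
    the vertex reached from the root by following the bits, and decompressed by
    walking up from that vertex, recording at each step whether one comes from a
    right child.  When a string is not recovered, some vertex on its path is a
    solution. *)
From mathcomp Require Import all_boot zify.
Require Import Defs.

Set Implicit Arguments.
Unset Strict Implicit.
Unset Printing Implicit Defensive.

(** * Functions of an input computed by shallow decision trees *)

Section DecisionTrees.

Variable sg : signature.

Definition computable (A : Type) (d : nat) (h : input sg -> A) : Prop :=
  exists2 t : dtree (query sg) A,
    depth t <= d & forall x, eval t (answer x) = h x.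

Fixpoint dtree_bind (Q A B : Type) (t : dtree Q A) (k : A -> dtree Q B) :
    dtree Q B :=
  match t with
  | Leaf a => k a
  | Node q t0 t1 => Node q (dtree_bind t0 k) (dtree_bind t1 k)
  end.

Lemma eval_bind (Q A B : Type) (t : dtree Q A) (k : A -> dtree Q B) a :
  eval (dtree_bind t k) a = eval (k (eval t a)) a.
Proof. by elim: t => //= q t0 IH0 t1 IH1; case: (a q). Qed.

Lemma depth_bind (Q A B : Type) (t : dtree Q A) (k : A -> dtree Q B) d :
  (forall a, depth (k a) <= d) -> depth (dtree_bind t k) <= depth t + d.
Proof.
move=> kd; elim: t => //= q t0 IH0 t1 IH1.
by rewrite addSn ltnS geq_max addn_maxl !leq_max IH0 IH1 orbT.
Qed.

Lemma computable_ext (A : Type) d (h h' : input sg -> A) :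
  h =1 h' -> computable d h -> computable d h'.
Proof. by move=> e [t td tE]; exists t => // x; rewrite tE e. Qed.

Lemma computable_leq (A : Type) d d' (h : input sg -> A) :
  d <= d' -> computable d h -> computable d' h.
Proof. by move=> dd' [t td tE]; exists t => //; apply: leq_trans dd'. Qed.

Lemma computable_cst (A : Type) d (a : A) : computable d (fun=> a).
Proof. by exists (Leaf _ a). Qed.

Lemma computable_comp (A B : Type) d (phi : A -> B) (h : input sg -> A) :
  computable d h -> computable d (fun x => phi (h x)).
Proof.
case=> t td tE; exists (dtree_bind t (fun a => Leaf _ (phi a))).
  by rewrite -[d]addn0; apply: leq_trans (leq_add td (leqnn 0)); apply: depth_bind.
by move=> x; rewrite eval_bind /= tE.
Qed.

Lemma computable_bind (A : finType) (B : Type) d1 d2 (h : input sg -> A)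
    (H : A -> input sg -> B) :
  computable d1 h -> (forall a, computable d2 (H a)) ->
  computable (d1 + d2) (fun x => H (h x) x).
Proof.
move=> [t td tE] Hc.
(* As [A] is finite, the continuation trees can be chosen simultaneously without an axiom of
   choice. *)
have /fin_all_exists[k kP] a : exists k, depth k <= d2 /\
    forall x, eval k (answer x) = H a x.
  by case: (Hc a) => k kd kE; exists k.
exists (dtree_bind t k).
  apply: leq_trans (leq_add td (leqnn d2)); apply: depth_bind => a.
  by case: (kP a).
by move=> x; rewrite eval_bind tE; case: (kP (h x)).
Qed.

Lemma computable_if (A : Type) d1 d2 (b : input sg -> bool)
    (h h' : input sg -> A) :
  computable d1 b -> computable d2 h -> computable d2 h' ->
  computable (d1 + d2) (fun x => if b x then h x else h' x).
Proof.
move=> bc hc hc'.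
by apply: (computable_bind (H := fun c x => if c then h x else h' x)) => // -[].
Qed.

Lemma computable_answers (qs : seq (query sg)) :
  computable (size qs) (fun x => [seq answer x q | q <- qs]).
Proof.
elim: qs => [|q qs IH] /=; first exact: computable_cst.
rewrite -add1n; apply: (computable_bind (h := fun x => answer x q)
  (H := fun b x => b :: [seq answer x q' | q' <- qs])).
  by exists (Node q (Leaf _ false) (Leaf _ true)) => //= x; case: (answer x q).
by move=> b; apply: computable_comp.
Qed.

(** All bits of the value are queried; they determine it, so a search over the codomain decodes
    them. Its default is never reached on the answers of an input. *)
Lemma computable_value (k : fsym sg) (i : 'I_(dom k)) :
  0 < cod k -> computable (bitlen (cod k)) (fun x => x k i).
Proof.
move=> cod_gt0.
pose bits (v : 'I_(cod k)) := [seq nat_bit v j | j : 'I_(bitlen (cod k))].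
have bits_inj v w : bits v = bits w -> v = w.
  move=> e; apply/val_inj/(@nat_bit_inj (bitlen (cod k))).
  - exact: leq_trans (ltn_ord _) (up_logP _ _).
  - exact: leq_trans (ltn_ord _) (up_logP _ _).
  move=> j lt_j.
  by move/eq_in_map: e => /(_ (Ordinal lt_j)); apply; rewrite mem_enum.
have := computable_answers
  [seq (Tagged _ (i, j) : query sg) | j : 'I_(bitlen (cod k))].
rewrite size_map size_enum_ord.
move=> /(computable_comp (fun s =>
  odflt (Ordinal cod_gt0) [pick v | bits v == s])).
apply: computable_ext => x; rewrite -map_comp -/(bits (x k i)).
case: pickP => [v /eqP e|/(_ (x k i))]; last by rewrite eqxx.
exact: (bits_inj v (x k i) e).
Qed.

End DecisionTrees.

(** * From computable maps to reductions of polylogarithmic cost *)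

Lemma reduces_via_computable (R S : search_problem) N M d
    (y : input (sig_of R N) -> input (sig_of S M))
    (z : solution S M -> input (sig_of R N) -> solution R N) :
  (forall k i, computable d (fun x => y x k i)) ->
  (forall s, computable d (z s)) ->
  (forall x s, is_sol (y x) s -> is_sol x (z s x)) ->
  exists T U, [/\ @reduces_via R S N M T U,
    forall q, depth (T q) <= d & forall s, depth (U s) <= d].
Proof.
move=> yc zc yzP.
(* Relabelling leaves turns a tree for a whole value into one of the same depth for each of its
   bits. *)
have /fin_all_exists[T TP] (q : query (sig_of S M)) :
    exists t : dtree (query (sig_of R N)) bool, depth t <= d /\
      forall x, eval t (answer x) = answer (y x) q.
  have [t td tE] := computable_comp (fun v => nat_bit (val v) (tagged q).2)
    (yc (tag q) (tagged q).1).
  by exists t.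
have /fin_all_exists[U UP] (s : solution S M) :
    exists t, depth t <= d /\ forall x, eval t (answer x) = z s x.
  by case: (zc s) => t td tE; exists t.
exists T, U; split=> [x|q|s]; last 2 first.
- by case: (TP q).
- by case: (UP s).
exists (y x); split=> [q|s sol_s]; first by case: (TP q).
by case: (UP s) => _ ->; apply: yzP.
Qed.

Lemma polylog_leq (a e : nat) (cost : nat -> nat) :
  (forall N, 0 < N -> cost N <= a * (up_log 2 N).+1 ^ e) -> polylog cost.
Proof.
(* As a summand the constant covers logarithm 0, where the bound is [a]; as a factor it absorbs
   [n + 1 <= 2 * n] raised to [e]; as an exponent it is at least [e]. *)
move=> costP; exists (a * 2 ^ e + e) => N N_gt0.
apply: leq_trans (costP N N_gt0) _.
case: (up_log 2 N) => [|n].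
  rewrite exp1n muln1; apply: leq_trans (leq_addl _ _).
  by apply: leq_trans (leq_addr _ _); rewrite leq_pmulr ?expn_gt0.
apply: leq_trans (leq_addr _ _).
apply: (@leq_trans (a * 2 ^ e * n.+1 ^ e)).
  rewrite -mulnA -expnMn leq_mul2l; apply/orP; right.
  by case: (posnP e) => [->|e_gt0] //; rewrite leq_exp2r //; lia.
by apply: leq_mul; rewrite ?leq_addr // leq_pexp2l ?leq_addl.
Qed.

Lemma dt_reducible_computable (R S : search_problem) (a e : nat) :
  (forall N, 0 < N -> exists M d,
    exists (y : input (sig_of R N) -> input (sig_of S M))
      (z : solution S M -> input (sig_of R N) -> solution R N),
    0 < M /\
    [/\ forall k i, computable d (fun x => y x k i),
        forall s, computable d (z s),
        forall x s, is_sol (y x) s -> is_sol x (z s x) &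
        up_log 2 (input_length S M) + d <= a * (up_log 2 N).+1 ^ e]) ->
  dt_reducible R S.
Proof.
move=> RS; exists (fun N => a * (up_log 2 N).+1 ^ e).
split=> [|N N_gt0]; first exact: (@polylog_leq a e).
have [M [d [y [z [M_gt0 [yc zc yzP cost_leq]]]]]] := RS N N_gt0.
exists M; split=> //.
have [T [U [TUP Td Ud]]] := reduces_via_computable yc zc yzP.
by exists T, U, d.
Qed.

Lemma card_query (sg : signature) :
  #|query sg| = \sum_(k : fsym sg) dom k * bitlen (cod k).
Proof.
rewrite card_tagged sumnE big_map big_enum.
by apply: eq_bigr => k _; rewrite card_prod !card_ord.
Qed.

Lemma bitlen_leq n : bitlen n <= n.
Proof. by rewrite up_log_min // ltnW // ltn_expl. Qed.

Lemma bitlen_double n : bitlen (2 * n) <= (bitlen n).+1.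
Proof. by rewrite up_log_min // expnS leq_mul2l up_logP. Qed.

Section OrdinalDouble.

Variable N : nat.

Lemma ord_double_subproof (v : 'I_N) (b : bool) : b + v.*2 < 2 * N.
Proof. by have := ltn_ord v; case: b; lia. Qed.

Definition ord_double v b : 'I_(2 * N) := Ordinal (ord_double_subproof v b).

Lemma ord_half_subproof (i : 'I_(2 * N)) : i./2 < N.
Proof. by have := ltn_ord i; lia. Qed.

Definition ord_half i : 'I_N := Ordinal (ord_half_subproof i).

Lemma ord_doubleK v b : ord_half (ord_double v b) = v.
Proof. by apply/val_inj; rewrite /= half_bit_double. Qed.

Lemma odd_ord_double v b : odd (ord_double v b) = b.
Proof. by rewrite /= oddD odd_double addbF oddb. Qed.

End OrdinalDouble.

(** * Reduction of Lossy-Code to Empty-Child *)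

Section LossyCodeToEmptyChild.

Variables (N : nat) (N_gt0 : 0 < N).

Notation lc_input := (input (lc_sig N)).

Implicit Types (x : lc_input) (b : bool) (u : 'I_N.+1).

(* Vertex [lift ord0 v] stands for [v]; its children are [g (2 g (2v + b))] and
   those of the root are [g (2 g b + 1)], with values counted from 0. *)
Definition base u : 'I_N := odflt (Ordinal N_gt0) (unlift ord0 u).

Definition inner_code x b u : 'I_(2 * N) :=
  ord_double (lc_g x (ord_double (base u) b)) (u == ord0).

Definition lc_child x b u : 'I_N.+1 := lift ord0 (lc_g x (inner_code x b u)).

(** Decodes what [lc_child] encodes: the parity of the inner code marks the children of the root,
    and otherwise two rounds of decoding and halving lead back to the father. *)
Definition lc_father x u : 'I_N.+1 :=
  if unlift ord0 u is Some w then
    if odd (lc_f x w) then ord0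
    else lift ord0 (ord_half (lc_f x (ord_half (lc_f x w))))
  else ord0.

Definition ec_of_lc x : input (ec_sig N.+1) :=
  fun k => if k is Some b then lc_child x b else lc_father x.

(** The second candidate is returned untested, so the result is not a solution exactly when neither
    candidate is. *)
Definition lc_branch_sol b u x : 'I_(2 * N) :=
  if lc_is_sol x (ord_double (base u) b) then ord_double (base u) b
  else inner_code x b u.

Definition lc_sol_of_ec u x : 'I_(2 * N) :=
  if lc_is_sol x (lc_branch_sol false u x) then lc_branch_sol false u x
  else lc_branch_sol true u x.

Lemma lc_branch_solPn x b u : ~~ lc_is_sol x (lc_branch_sol b u x) ->
  lc_f x (lc_g x (ord_double (base u) b)) = ord_double (base u) b /\
  lc_f x (lc_g x (inner_code x b u)) = inner_code x b u.
Proof.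
rewrite /lc_branch_sol; case: ifP => [-> //|].
by move=> /negbT; rewrite /lc_is_sol !negbK => /eqP-> /eqP->.
Qed.

(** By contraposition: if all four codes used for the children of [u] are recovered, both children
    have father [u], they differ, and neither is the root, which is its own father by definition. *)
Lemma lc_sol_of_ecP x u :
  ec_is_sol (ec_of_lc x) u -> lc_is_sol x (lc_sol_of_ec u x).
Proof.
apply: contraLR => nosol.
have codeP b : lc_f x (lc_g x (ord_double (base u) b)) = ord_double (base u) b /\
    lc_f x (lc_g x (inner_code x b u)) = inner_code x b u.
  apply: lc_branch_solPn; move: nosol; rewrite /lc_sol_of_ec.
  by case: ifP => [-> //|/negbT]; case: b.
have childK b : lc_father x (lc_child x b u) = u.
  rewrite /lc_father /lc_child liftK; have [jE ->] := codeP b.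
  rewrite odd_ord_double; case: eqP => [-> //|/eqP u_neq0].
  rewrite ord_doubleK jE ord_doubleK /base.
  by case: unliftP u_neq0 => [v -> //|->]; rewrite eqxx.
(* Equal children would decode to equal inner codes, and these to equal outer codes, whose parities
   differ. *)
have child_inj : lc_child x false u != lc_child x true u.
  apply/eqP => /lift_inj eq_g.
  have := congr1 (@ord_half N) (congr1 (lc_f x) eq_g).
  rewrite !(codeP _).2 !ord_doubleK => /(congr1 (lc_f x)).
  rewrite !(codeP _).1 => /(congr1 (fun i : 'I__ => odd i)).
  by rewrite !odd_ord_double.
rewrite /ec_is_sol /ec_s1 /ec_s2 /ec_F /ec_L /ec_R /=.
rewrite !childK eqxx (negPf child_inj) /= negb_and.
case: (altP (val u =P 0)) => //= u0.
have -> : u = ord0 by apply: val_inj.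
rewrite /lc_father unlift_none /lc_child !(eq_sym _ ord0).
by rewrite !(negPf (neq_lift _ _)) eqxx.
Qed.

Let m := bitlen (2 * N).

Lemma computable_lc_g i : computable m (fun x => lc_g x i).
Proof.
apply: (computable_leq _ (@computable_value (lc_sig N) true i N_gt0)).
by apply: leq_up_log; rewrite leq_pmull.
Qed.

Lemma computable_lc_f v : computable m (fun x => lc_f x v).
Proof. by apply: (@computable_value (lc_sig N) false v); rewrite /= muln_gt0. Qed.

Lemma computable_lc_is_sol i : computable (m + m) (fun x => lc_is_sol x i).
Proof.
apply: (computable_bind (h := fun x => lc_g x i) (H := fun v x => lc_f x v != i)).
  exact: computable_lc_g.
by move=> v; apply: (computable_comp (fun j => j != i)); apply: computable_lc_f.
Qed.

Lemma computable_inner_code b u : computable m (fun x => inner_code x b u).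
Proof.
apply: (computable_comp (fun v => ord_double v (u == ord0))).
exact: computable_lc_g.
Qed.

Lemma computable_ec_of_lc k u : computable (m + m) (fun x => @ec_of_lc x k u).
Proof.
case: k => [b|]; rewrite /= /lc_father.
  apply: (computable_comp (lift ord0)).
  apply: (computable_bind (h := fun x => inner_code x b u)
    (H := fun i x => lc_g x i)) (computable_lc_g).
  exact: computable_inner_code.
case: (unlift ord0 u) => [w|]; last exact: computable_cst.
apply: (computable_bind (h := fun x => lc_f x w) (H := fun j x =>
  if odd j then ord0 else lift ord0 (ord_half (lc_f x (ord_half j))))).
  exact: computable_lc_f.
move=> j; case: (odd j); first exact: computable_cst.
apply: (computable_comp (fun i => lift ord0 (ord_half i))).
exact: computable_lc_f.
Qed.

Lemma computable_lc_branch_sol b u : computable (m + m + m) (lc_branch_sol b u).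
Proof.
apply: computable_if; first exact: computable_lc_is_sol.
  exact: computable_cst.
exact: computable_inner_code.
Qed.

Lemma computable_lc_sol_of_ec u : computable (8 * m) (lc_sol_of_ec u).
Proof.
(* Find the first candidate, test it, then compute the one to return. *)
apply: (@computable_leq _ _ ((m + m + m + (m + m)) + (m + m + m))); first by lia.
apply: computable_if; [|exact: computable_lc_branch_sol..].
apply: (computable_bind (h := lc_branch_sol false u)
  (H := fun i x => lc_is_sol x i)); first exact: computable_lc_branch_sol.
exact: computable_lc_is_sol.
Qed.

End LossyCodeToEmptyChild.

Lemma Lossy_Code_reducible_Empty_Child : dt_reducible Lossy_Code Empty_Child.
Proof.
(* With [l = bitlen N], the cost is at most [(4 + 2 * l) + 8 * (l + 1) <= 12 * (l + 1)]. *)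
apply: (@dt_reducible_computable _ _ 12 1) => N N_gt0.
exists N.+1, (8 * bitlen (2 * N)), (@ec_of_lc N N_gt0), (@lc_sol_of_ec N N_gt0).
split=> //; split.
- move=> k i.
  by apply: (computable_leq _ (@computable_ec_of_lc N N_gt0 k i)); lia.
- exact: computable_lc_sol_of_ec.
- exact: lc_sol_of_ecP.
have len_leq : input_length Empty_Child N.+1 <= 2 ^ (4 + 2 * bitlen N).
  rewrite /input_length card_query /= sum_nat_const card_option card_bool.
  have := bitlen_leq N.+1; have : N <= 2 ^ bitlen N by apply: up_logP.
  rewrite mul2n -addnn !expnD; nia.
have := up_log_min (isT : 1 < 2) len_leq; have := bitlen_double N.
rewrite /bitlen /= expn1; lia.
Qed.

(** * Reduction of Empty-Child to Lossy-Code *)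

Section EmptyChildToLossyCode.

Variables (N : nat) (N_gt0 : 0 < N).

Notation ec_input := (input (ec_sig N)).

Implicit Types (x : ec_input) (u : 'I_N).

Let root : 'I_N := Ordinal N_gt0.

(** The low bit of [j] is the last step of the descent, hence the first one that [code] reads off
    while climbing. *)
Fixpoint walk k j x : 'I_N :=
  if k is k'.+1 then x (Some (odd j)) (walk k' j./2 x) else root.

Fixpoint code k u x : nat :=
  if k is k'.+1 then
    (ec_R x (ec_F x u) == u) + (code k' (ec_F x u) x).*2
  else 0.

Fixpoint walk_sol k j x : 'I_N :=
  if k is k'.+1 then
    if ec_is_sol x (walk k' j./2 x) then walk k' j./2 x else walk_sol k' j./2 x
  else root.

(* The invariant excludes self-loops [F u = L u = R u = u], which are no
   solutions but where the two children coincide. *)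
Lemma walkK k j x : j < 2 ^ k -> ~~ ec_is_sol x (walk_sol k j x) ->
  ((walk k j x == root) || (ec_F x (walk k j x) != walk k j x)) /\
  code k (walk k j x) x = j.
Proof.
elim: k j => [|k IHk] j; first by case: j => //; rewrite eqxx.
move=> lt_j /=; case: ifP => [-> //|/negbT nosol_u nosol].
have lt_j2 : j./2 < 2 ^ k by move: lt_j; rewrite expnS; lia.
have [] := IHk _ lt_j2 nosol.
set u := walk k j./2 x in nosol_u * => u_ok codeE.
move: nosol_u; rewrite /ec_is_sol /ec_s1 /ec_s2 !negb_or !negbK.
rewrite negb_and negbK => /andP[/and3P[/eqP FL /eqP FR neqLR] nos2].
have childK b : ec_F x (x (Some b) u) = u by case: b.
(* If [u] were its own child it would be its own father, hence the root by the invariant, and there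
   (s2) holds. *)
have child_neq b : x (Some b) u != u.
  apply: contraTN u_ok => /eqP loop.
  move: (childK b); rewrite loop => Fu; rewrite Fu eqxx orbF.
  apply: contraNN nos2 => /eqP uE.
  by rewrite {1}uE /= /ec_L /ec_R; case: b loop => ->; rewrite eqxx ?orbT.
split; first by rewrite childK (eq_sym u) child_neq orbT.
rewrite childK codeE -[RHS]odd_double_half; congr (nat_of_bool _ + _).
case: (odd j); first by rewrite /ec_R eqxx.
(* After a left step the recorded bit is correct only if the children differ; without (s1) they can
   coincide only at a self-loop, which [child_neq] excludes. *)
case/orP: neqLR => [|/eqP e]; first by rewrite eq_sym => /negPf.
by have := child_neq true; rewrite -/(ec_R x u) e eqxx.
Qed.

Let n := bitlen N.

Lemma double_leq_exp : 2 * N <= 2 ^ n.+1.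
Proof. by rewrite expnS leq_mul2l up_logP. Qed.

(** A code of [n.+1] bits may lie outside [2N]. The default used then is harmless, as a recovered
    code is in range. *)
Definition lc_of_ec x : input (lc_sig N) :=
  fun k => match k return 'I_(if k then 2 * N else N) ->
                          'I_(if k then N else 2 * N) with
    | true => fun i => walk n.+1 i x
    | false => fun u => insubd (ord_double u false) (code n.+1 u x)
    end.

Lemma walk_solP x (i : 'I_(2 * N)) :
  lc_is_sol (lc_of_ec x) i -> ec_is_sol x (walk_sol n.+1 i x).
Proof.
apply: contraLR => /walkK[]; first exact: leq_trans (ltn_ord i) double_leq_exp.
move=> _ codeE; rewrite /lc_is_sol negbK; apply/eqP/val_inj.
by rewrite [LHS]val_insubd codeE ltn_ord.
Qed.

Lemma computable_ec k u : computable n (fun x : ec_input => x k u).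
Proof. exact: (@computable_value (ec_sig N) k u N_gt0). Qed.

Lemma computable_ec_is_sol u : computable (5 * n) (fun x => ec_is_sol x u).
Proof.
apply: (@computable_leq _ _ (n + (n + (n + (n + n))))); first by lia.
(* [sol] is the test as a function of the five values it depends on, which are then read one by
   one. *)
pose sol l r fl fr fu := [|| fl != u, fr != u | (l == r) && (r != u)]
  || (val u == 0) && [|| l == u, r == u | fu != u].
apply: (computable_bind (h := fun x => ec_L x u) (H := fun l x =>
  sol l (ec_R x u) (ec_F x l) (ec_F x (ec_R x u)) (ec_F x u)));
  first exact: computable_ec.
move=> l; apply: (computable_bind (h := fun x => ec_R x u) (H := fun r x =>
  sol l r (ec_F x l) (ec_F x r) (ec_F x u))); first exact: computable_ec.
move=> r; apply: (computable_bind (h := fun x => ec_F x l) (H := fun fl x =>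
  sol l r fl (ec_F x r) (ec_F x u))); first exact: computable_ec.
move=> fl; apply: (computable_bind (h := fun x => ec_F x r) (H := fun fr x =>
  sol l r fl fr (ec_F x u))); first exact: computable_ec.
by move=> fr; apply: computable_comp; apply: computable_ec.
Qed.

Lemma computable_walk k j : computable (k * n) (walk k j).
Proof.
elim: k j => [|k IHk] j /=; first exact: computable_cst.
rewrite mulSn addnC; apply: (computable_bind (h := walk k j./2)
  (H := fun u x => x (Some (odd j)) u)) => // u; exact: computable_ec.
Qed.

Lemma computable_code k u : computable (k * (2 * n)) (code k u).
Proof.
elim: k u => [|k IHk] u /=; first exact: computable_cst.
apply: (@computable_leq _ _ (n + (n + k * (2 * n)))); first by lia.
apply: (computable_bind (h := fun x => ec_F x u) (H := fun p x =>
  (ec_R x p == u) + (code k p x).*2)); first exact: computable_ec.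
move=> p; apply: (computable_bind (h := fun x => ec_R x p) (H := fun r x =>
  (r == u) + (code k p x).*2)); first exact: computable_ec.
by move=> r; apply: (computable_comp (fun c => (r == u) + c.*2)).
Qed.

(** Each of the [k] vertices tested is reached by a new walk from the root, of depth at most
    [k * n], and tested at depth [5 * n]. *)
Lemma computable_walk_sol k j : computable (k * (k + 5) * n) (walk_sol k j).
Proof.
elim: k j => [|k IHk] j /=; first exact: computable_cst.
apply: (@computable_leq _ _ (k * n + (5 * n + k * (k + 5) * n))); first by nia.
apply: (computable_bind (h := walk k j./2) (H := fun u x =>
  if ec_is_sol x u then u else walk_sol k j./2 x)); first exact: computable_walk.
move=> u; apply: computable_if => //; first exact: computable_ec_is_sol.
exact: computable_cst.
Qed.

Lemma computable_lc_of_ec k i :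
  computable (n.+1 * (2 * n)) (fun x => @lc_of_ec x k i).
Proof.
case: k i => i /=.
  by apply: computable_leq (computable_walk n.+1 i); nia.
exact: (computable_comp (insubd (ord_double i false))) (computable_code n.+1 i).
Qed.

End EmptyChildToLossyCode.

Lemma Empty_Child_reducible_Lossy_Code : dt_reducible Empty_Child Lossy_Code.
Proof.
(* The cost is at most [(2 + 2 * n) + (n + 1) * (n + 6) * n]; the cubic term comes from repeating
   the walks. *)
apply: (@dt_reducible_computable _ _ 10 3) => N N_gt0.
pose n := bitlen N.
exists N, (n.+1 * (n.+1 + 5) * n), (@lc_of_ec N N_gt0),
  (fun i : 'I_(2 * N) => walk_sol N_gt0 n.+1 i).
split=> //; split.
- move=> k i.
  by apply: (computable_leq _ (@computable_lc_of_ec N N_gt0 k i)); nia.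
- by move=> i; apply: computable_walk_sol.
- exact: walk_solP.
have len_leq : input_length Lossy_Code N <= 2 ^ (2 + 2 * n).
  rewrite /input_length card_query /= big_bool /=.
  have := bitlen_leq N; have := bitlen_leq (2 * N).
  have : N <= 2 ^ n by apply: up_logP.
  rewrite mul2n -addnn !expnD; nia.
have := up_log_min (isT : 1 < 2) len_leq.
rewrite -/(bitlen N) -/n !expnS expn0; nia.
Qed.

Theorem theorem1p6 : dt_equiv Empty_Child Lossy_Code.
Proof.
split; first exact: Empty_Child_reducible_Lossy_Code.
exact: Lossy_Code_reducible_Empty_Child.
Qed.
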